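(* Every nonempty countable (zero-dimensional) Polish space $X$ satisfies the alternating property: for every ordinal $\alpha\ge1$ with $\alpha+1<\Theta_X$, $\alpha\in\mathrm{SD}_X\iff\alpha+1\in\mathrm{NSD}_X$.
   Context: Base theory $\mathsf{ZF}+\mathsf{DC}(\mathbb R)$ (no determinacy hypothesis beyond Borel determinacy is needed since every subset of a countable Polish space is Borel). For $A,B\subseteq X$, $A\le_{\mathsf W}^X B$ means there is a continuous $f\colon X\to X$ with $f^{-1}(B)=A$; $<_{\mathsf W}^X$ is the strict part. $A$ is selfdual if $A\le_{\mathsf W}^X X\setminus A$, nonselfdual otherwise. The Wadge rank is $\mathrm{rk}(A)=\sup(\{1\}\cup\{\mathrm{rk}(B)+1:B<_{\mathsf W}^XA\})$, $\Theta_X=\sup\{\mathrm{rk}(A)+1:A\subseteq X\}$, and for $1\le\alpha<\Theta_X$, $\alpha\in\mathrm{SD}_X$ if the subsets of $X$ of Wadge rank $\alpha$ are selfdual, $\alpha\in\mathrm{NSD}_X$ otherwise. *)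

(* Defs.v *)
From mathcomp Require Import all_boot all_order all_algebra.
From mathcomp Require Import all_classical all_reals all_analysis.

Set Implicit Arguments.
Unset Strict Implicit.
Unset Printing Implicit Defensive.

Import Order.TTheory GRing.Theory Num.Theory.

Local Open Scope classical_set_scope.
Local Open Scope ring_scope.

(* Ordinals as well-founded trees: [OSup I f] denotes the least ordinal
   strictly greater than every [f i].  Distinct trees may denote the same
   ordinal, so equality of ordinals is [oeq], not [=]. *)
Inductive Ord : Type := OSup (I : Type) (f : I -> Ord).

Definition oidx (a : Ord) : Type := match a with OSup J _ => J end.

Definition obranch (a : Ord) : oidx a -> Ord :=
  match a with OSup _ f => f end.

Fixpoint ole (a b : Ord) {struct a} : Prop :=
  match a, b with
  | OSup J f, OSup K g => forall j : J, exists k : K, ole (f j) (g k)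
  end.

Definition olt (a b : Ord) : Prop := exists j : oidx b, ole a (obranch j).

Definition oeq (a b : Ord) : Prop := ole a b /\ ole b a.

Definition ozero : Ord := OSup (fun i : void => match i with end).

Definition osucc (a : Ord) : Ord := OSup (fun _ : unit => a).

Definition oone : Ord := osucc ozero.

(* The non-strict supremum of a family: an ordinal is below it iff it is below
   some member, hence the branches of all the [f i] put together. *)
Definition olub (I : Type) (f : I -> Ord) : Ord :=
  OSup (fun p : {i : I & oidx (f i)} => obranch (projT2 p)).

Lemma ole_refl a : ole a a.
Proof. by elim: a => I f IH /= i; exists i. Qed.

Lemma ole_trans b a c : ole a b -> ole b c -> ole a c.
Proof.
elim: a b c => I f IH [J g] [K h] /= ab bc i.
have [j fg] := ab i; have [k gh] := bc j.
by exists k; apply: IH fg gh.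
Qed.

Lemma oltNge a b : olt a b <-> ~ ole b a.
Proof.
split.
  elim: a b => I f IH [J g] [/= j fg] gf.
  have [i gfi] := gf j; apply: (IH i (g j)) gfi.
  by case: (g j) fg => K h /= /(_ i).
elim: b a => J g IH [I f] nle.
have /existsNP[j /forallNP gf] : ~ forall j, exists i, ole (g j) (f i) := nle.
exists j; move: (IH j) gf => /=; case: (g j) => K h IHj gf i.
exact: IHj (gf i).
Qed.

Lemma obranch_le a (i : oidx a) : ole (obranch i) a.
Proof.
elim: a i => I f IH /= i; have := IH i; case fi: (f i) => [K h] H k.
by exists i; rewrite fi; exact: H.
Qed.

Lemma ole_total a b : ole a b \/ ole b a.
Proof.
have [|/oltNge[i bai]] := pselect (ole a b); first by left.
by right; exact: ole_trans bai (obranch_le i).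
Qed.

Lemma olt_wf : well_founded olt.
Proof.
suff H : forall b a, ole a b -> Acc olt a by move=> a; exact: H (ole_refl a).
elim=> J g IH [I f] /= ab; split=> c [/= i cf].
by have [j fg] := ab i; apply: (IH j); apply: ole_trans fg.
Qed.

Lemma osuccP a b : ole (osucc a) b <-> olt a b.
Proof. by case: b => J g; split=> [/(_ tt)|h []]. Qed.

Lemma oleP a b : ole a b <-> forall i : oidx a, olt (obranch i) b.
Proof. by case: a b => J f [K g]. Qed.

Lemma olubP I (f : I -> Ord) b : ole (olub f) b <-> forall i, ole (f i) b.
Proof.
split=> [/oleP H i|H]; apply/oleP; first by move=> k; exact: H (existT _ i k).
by case=> i k; have /oleP := H i; apply.
Qed.

Definition wadge_le (X : topologicalType) (A B : set X) : Prop :=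
  exists2 f : X -> X, continuous f & f @^-1` B = A.

Definition wadge_lt (X : topologicalType) (A B : set X) : Prop :=
  wadge_le A B /\ ~ wadge_le B A.

Definition selfdual (X : topologicalType) (A : set X) : Prop :=
  wadge_le A (~` A).

(* sup ({1} U {rk(B) + 1 : B <_W A}), where [None] indexes the element 1. *)
Fixpoint wadge_rank_acc (X : topologicalType) (A : set X)
    (accA : Acc (@wadge_lt X) A) {struct accA} : Ord :=
  olub (fun o : option {B : set X | wadge_lt B A} =>
    match o with
    | None => oone
    | Some B => osucc (wadge_rank_acc (Acc_inv accA (proj2_sig B)))
    end).

(* Sets outside the well-founded part of the Wadge order get the value 0, which
   is not a Wadge rank; there are no such sets when the order is well founded,
   and then [wadge_rank] satisfies the usual recursion, see [wadge_rankE]. *)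
Definition wadge_rank (X : topologicalType) (A : set X) : Ord :=
  match pselect (Acc (@wadge_lt X) A) with
  | left accA => wadge_rank_acc accA
  | right _ => ozero
  end.

Lemma wadge_rankE (X : topologicalType) (A : set X) :
  Acc (@wadge_lt X) A ->
  wadge_rank A =
    olub (fun o : option {B : set X | wadge_lt B A} =>
      match o with
      | None => oone
      | Some B => osucc (wadge_rank (proj1_sig B))
      end).
Proof.
rewrite /wadge_rank; case: pselect => // -[accA] _ /=.
congr olub; apply/funext => -[[B ltBA]|//] /=.
congr osucc; case: pselect => [accB|/(_ (accA _ ltBA))//].
by congr wadge_rank_acc; exact: Prop_irrelevance.
Qed.

(* Theta_X = sup {rk(A) + 1 : A subset of X} *)
Definition wadge_length (X : topologicalType) : Ord :=
  olub (fun A : set X => osucc (wadge_rank A)).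

Definition SD (X : topologicalType) (a : Ord) : Prop :=
  [/\ ole oone a, olt a (wadge_length X) &
      forall A : set X, oeq (wadge_rank A) a -> selfdual A].

Definition NSD (X : topologicalType) (a : Ord) : Prop :=
  [/\ ole oone a, olt a (wadge_length X) & ~ SD X a].

Definition alternating_property (X : topologicalType) : Prop :=
  forall a : Ord, ole oone a -> olt (osucc a) (wadge_length X) ->
    (SD X a <-> NSD X (osucc a)).

Definition is_metric (R : realType) (X : Type) (d : X -> X -> R) : Prop :=
  [/\ forall x y, 0 <= d x y,
      forall x y, d x y = 0 <-> x = y,
      forall x y, d x y = d y x &
      forall x y z, d x z <= d x y + d y z].

Definition metric_induces_topology (R : realType) (X : topologicalType)
    (d : X -> X -> R) : Prop :=
  forall (x : X) (U : set X),
    nbhs x U <-> exists2 e : R, 0 < e & [set y | d x y < e] `<=` U.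

Definition complete_metric (R : realType) (X : Type) (d : X -> X -> R) : Prop :=
  forall u : nat -> X,
    (forall e : R, 0 < e ->
       exists N : nat, forall m n : nat, (N <= m)%N -> (N <= n)%N ->
         d (u m) (u n) < e) ->
    exists l : X, forall e : R, 0 < e ->
      exists N : nat, forall n : nat, (N <= n)%N -> d l (u n) < e.

Definition polish (R : realType) (X : topologicalType) : Prop :=
  (exists2 D : set X, countable D & dense D) /\
  exists d : X -> X -> R,
    [/\ is_metric d, metric_induces_topology d & complete_metric d].

(* Main.v *)
(* X is scattered and has a base of clopen sets.  For A a subset of X, iterate
   along the ordinals the derivative sending a closed F to the set of points of F
   near which F meets both A and its complement; scatteredness makes this reach
   the empty set, so each point x gets a rank rho_A(x).  Order the pairs
   (rho_A(x), [x in A]) by strict inequality of ranks.  Then A is Wadge below B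
   iff every pair of A is dominated by a pair of B: local reductions are built by
   induction on scatteredness and glued along clopen covers.  Hence the degree of
   A is an initial segment of Ord x 2, either symmetric (selfdual) or with a
   one-sided top (nonselfdual).  Between two selfdual degrees one finds a set
   having a single point of top rank, and between two nonselfdual ones a set
   having two points of the same top rank, one on each side; so consecutive
   degrees alternate. *)
Require Import Defs.
From mathcomp Require Import all_boot all_order all_algebra.
From mathcomp Require Import all_classical all_reals all_analysis.
From mathcomp Require Import lra.

Set Implicit Arguments.
Unset Strict Implicit.
Unset Printing Implicit Defensive.

Import Order.TTheory GRing.Theory Num.Theory.

Local Open Scope classical_set_scope.
Local Open Scope ring_scope.

(** * Mixed order laws for tree ordinals *)

Lemma ole_olt_trans b a c : ole a b -> olt b c -> olt a c.
Proof. by move=> ab [j bj]; exists j; exact: ole_trans bj. Qed.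

Lemma olt_ole_trans b a c : olt a b -> ole b c -> olt a c.
Proof. by move=> /osuccP ab bc; apply/osuccP; exact: ole_trans bc. Qed.

Lemma oltW a b : olt a b -> ole a b.
Proof. by case=> j aj; exact: ole_trans (obranch_le j). Qed.

Lemma olt_irr a : ~ olt a a.
Proof. by move/oltNge; apply; exact: ole_refl. Qed.

Lemma oleNgt a b : ~ ole a b -> olt b a.
Proof. by move/oltNge. Qed.

Lemma ole_olt_or_ge a b : ole a b -> olt a b \/ ole b a.
Proof. by move=> ab; have [|/oleNgt] := pselect (ole b a); [right|left]. Qed.

Lemma olubP_lt I (f : I -> Ord) b : olt b (olub f) <-> exists i, olt b (f i).
Proof.
split=> [[[i k] bk]|[i [k bk]]]; first by exists i, k.
by exists (existT _ i k).
Qed.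

(** * Countable complete metric spaces: clopen bases and scatteredness *)

Definition scattered (T : topologicalType) : Prop :=
  forall S : set T, S !=set0 ->
    exists2 x, S x & \forall z \near x, S z -> z = x.

Definition clopen_base (T : topologicalType) : Prop :=
  forall (x : T) (U : set T), nbhs x U ->
    exists V : set T, [/\ clopen V, V x & V `<=` U].

Lemma open_near (T : topologicalType) (U : set T) x :
  open U -> U x -> \forall z \near x, U z.
Proof. by move=> oU Ux; exact: open_nbhs_nbhs. Qed.

Lemma metric_gt0 (R : realType) (T : Type) (d : T -> T -> R) x y :
  is_metric d -> x <> y -> 0 < d x y.
Proof.
move=> [d0 dE _ _] xy; rewrite lt_neqAle d0 andbT eq_sym.
by apply/eqP => /dE.
Qed.

(** A countable set is Lebesgue null, whereas the interval from 0 to [e] has measure [e]. *)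
Lemma countable_avoid (R : realType) (D : set R) (e : R) :
  countable D -> 0 < e -> exists r, [/\ 0 < r, r < e & ~ D r].
Proof.
move=> cD e0; apply: contrapT => H.
have sub : `]0, e[%classic `<=` D.
  move=> r /=; rewrite in_itv /= => /andP[r0 re]; apply: contrapT => nD.
  by apply: H; exists r.
have cI : countable `]0, e[%classic by apply: sub_countable cD; exact: subset_card_le.
have := countable_lebesgue_measure0 cI.
rewrite lebesgue_measure_itv /= lte_fin e0 -EFinB subr0 => -[e00].
by rewrite e00 ltxx in e0.
Qed.

(** Only countably many distances from [x] are attained. A ball whose radius is not attained
    coincides with the closed ball, so it is clopen. *)
Lemma countable_metric_clopen_base (R : realType) (T : topologicalType)
    (d : T -> T -> R) :
  is_metric d -> metric_induces_topology d -> countable [set: T] ->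
  clopen_base T.
Proof.
move=> [d0 dE dC dT] td cT x U /td[e e0 eU].
have cD : countable (d x @` [set: T]).
  exact: card_le_trans (card_image_le _ _) cT.
have [r [r0 re nD]] := countable_avoid cD e0.
exists [set z | d x z < r]; split => //; last 2 first.
- by rewrite /= (dE x x).2.
- by move=> z /= zr; apply: eU; exact: lt_trans re.
split.
  rewrite openE => z /= zr; apply/td; exists (r - d x z); first by rewrite subr_gt0.
  by move=> w /=; have := dT x z w; lra.
rewrite -openC openE => z /= /negP; rewrite -leNgt => rz; apply/td.
have {}rz : r < d x z.
  by rewrite lt_neqAle rz andbT; apply/eqP => rE; apply: nD; exists z.
exists (d x z - r); first by rewrite subr_gt0.
by move=> w /= zw; apply/negP; rewrite -leNgt; have := dT x w z; rewrite (dC w z); lra.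
Qed.

(* Cantor scheme: if no point of S were isolated, shrinking balls centered in S
   could avoid the points of T one at a time, and their limit would be missing. *)
Lemma countable_complete_scattered (R : realType) (T : topologicalType)
    (d : T -> T -> R) :
  is_metric d -> metric_induces_topology d -> complete_metric d ->
  countable [set: T] -> scattered T.
Proof.
move=> [d0 dE dC dT] td compl /countable_injP[c cI] S [s0 Ss0].
apply: contrapT => niso.
have {}cI x y : c x = c y -> x = y by apply: cI; rewrite in_setT.
have dxx x : d x x = 0 by apply/dE.
have dne x y := metric_gt0 (x := x) (y := y) (And4 d0 dE dC dT).
have away s r x : S s -> 0 < r -> exists s', [/\ S s', d s s' < r & s' <> x].
  move=> Ss r0; have [sx|sx] := pselect (s = x); last by exists s; rewrite dxx.
  apply: contrapT => nex; apply: niso; exists s => //; apply/td; exists r => //.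
  move=> z /= zr Sz; apply: contrapT => zs; apply: nex; exists z.
  by split => //; rewrite -sx.
(* One stage of the scheme: from stage [n] and a ball (center, radius), a smaller ball inside it,
   still centered in [S], that leaves out the point numbered [n] by [c]. *)
have step (np : nat * (T * R)) : exists q : T * R,
    S np.2.1 -> 0 < np.2.2 -> [/\ S q.1, 0 < q.2,
      d np.2.1 q.1 + q.2 <= np.2.2, q.2 <= np.1.+1%:R^-1 &
      forall x, c x = np.1 -> q.2 < d q.1 x].
  case: np => n [s r] /=; have [[Ss r0]|nv] := pselect (S s /\ 0 < r); last first.
    by exists (s, r) => Ss r0; case: nv.
  have [s' [Ss' ss' nx]] : exists s',
      [/\ S s', d s s' < r & forall x, c x = n -> s' <> x].
    have [[x xn]|nx] := pselect (exists x, c x = n).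
      have [s' [Ss' ss' s'x]] := away s r x Ss r0; exists s'; split => // y yn.
      by have -> : y = x by apply: cI; rewrite yn.
    by exists s; rewrite dxx; split => // x xn; case: nx; exists x.
  have n0 : 0 < n.+1%:R^-1 :> R by rewrite invr_gt0.
  have [t [t0 tx]] : exists t, 0 < t /\ forall x, c x = n -> t < d s' x.
    have [[x xn]|nex] := pselect (exists x, c x = n); last first.
      by exists 1; split => // x xn; case: nex; exists x.
    have dx := dne _ _ (nx x xn).
    exists (d s' x / 2); split; first by lra.
    move=> y yn; have -> : y = x by apply: cI; rewrite yn.
    by lra.
  exists (s', Num.min (r - d s s') (Num.min n.+1%:R^-1 t)) => _ _ /=; split => //.
  - by rewrite !lt_min subr_gt0 ss' n0.
  - by rewrite -lerBrDl ge_min lexx.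
  - by rewrite !ge_min lexx orbT.
  - by move=> x /tx; apply: le_lt_trans; rewrite !ge_min lexx !orbT.
have {step} /choice[F FP] := step.
pose p := fix p n := if n is m.+1 then F (m, p m) else (s0, 1).
have pv n : S (p n).1 /\ 0 < (p n).2.
  elim: n => [|n [Sn pn]] //=.
  by have [] := FP (n, p n) Sn pn.
have pS n : [/\ d (p n).1 (p n.+1).1 + (p n.+1).2 <= (p n).2,
    (p n.+1).2 <= n.+1%:R^-1 & forall x, c x = n -> (p n.+1).2 < d (p n.+1).1 x].
  by have [Sn pn] := pv n; have [] := FP (n, p n) Sn pn.
have chain n k : d (p n).1 (p (n + k)%N).1 + (p (n + k)%N).2 <= (p n).2.
  elim: k => [|k IH]; first by rewrite addn0 dxx add0r.
  rewrite addnS; have [h _ _] := pS (n + k)%N.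
  by have := dT (p n).1 (p (n + k)%N).1 (p (n + k).+1).1; lra.
have chain_le n m : (n <= m)%N -> d (p n).1 (p m).1 <= (p n).2.
  by move=> /subnKC <-; have := chain n (m - n)%N; have := (pv (n + (m - n))%N).2; lra.
have [e e0|l lP] := compl (fun n => (p n).1).
  have e20 : 0 < e / 2 by lra.
  have [N _ NP] := near_infty_natSinv_lt (PosNum e20).
  exists N.+1 => m n Nm Nn.
  have [_ h _] := pS N; have {h}hN : (p N.+1).2 < e / 2 := le_lt_trans h (NP N (leqnn N)).
  have := chain_le _ _ Nm; have := chain_le _ _ Nn.
  by have := dT (p m).1 (p N.+1).1 (p n).1; rewrite (dC (p m).1 (p N.+1).1); lra.
have lB n : d (p n).1 l <= (p n).2.
  rewrite leNgt; apply/negP => lt.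
  have [|N NP] := lP (d (p n).1 l - (p n).2); first by rewrite subr_gt0.
  have /= := NP _ (leq_maxl N n); have := chain_le _ _ (leq_maxr N n).
  by have := dT (p n).1 (p (maxn N n)).1 l; rewrite (dC (p (maxn N n)).1 l); lra.
(* The limit [l] lies in all the balls, but stage [c l] excluded it. *)
by have [_ _ /(_ l erefl)] := pS (c l); rewrite ltNge lB.
Qed.

(** * The oscillation derivative and its rank *)

Section WadgeOrder.
Context {T : topologicalType}.
Implicit Types (A B C F U : set T) (a : Ord).

(** The boundary of [A] relative to the subspace [F]. *)
Definition osc_deriv A F : set T :=
  F `&` closure (F `&` A) `&` closure (F `&` ~` A).

(** Intersecting the derivatives of all earlier stages treats zero (the whole space), successors and
    limits uniformly. *)
Fixpoint osc_iter A a : set T :=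
  match a with
  | OSup J f => [set x | forall j : J, osc_deriv A (osc_iter A (f j)) x]
  end.

Lemma osc_deriv_sub A F : osc_deriv A F `<=` F.
Proof. by move=> x [[]]. Qed.

Lemma osc_derivS A F G : F `<=` G -> osc_deriv A F `<=` osc_deriv A G.
Proof.
move=> FG x [[Fx cA] cnA]; split; first split; first exact: FG.
- by apply: closure_subset cA; exact: setSI.
- by apply: closure_subset cnA; exact: setSI.
Qed.

Lemma osc_derivP A F x : osc_deriv A F x ->
  forall (U : set T) (P : Prop), nbhs x U -> exists z, [/\ U z, F z & (A z <-> P)].
Proof.
move=> [[_ cA] cnA] U P nU; have [p|np] := pselect P.
  by have [z [[Fz Az] Uz]] := cA U nU; exists z.
by have [z [[Fz Az] Uz]] := cnA U nU; exists z.
Qed.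

Lemma osc_deriv_near A F x : F x -> ~ osc_deriv A F x ->
  \forall z \near x, F z -> (A z <-> A x).
Proof.
move=> Fx ndx; apply: contrapT => nnear; apply: ndx.
have H (P : set T) : (forall z, (A z <-> A x) \/ P z) -> closure (F `&` P) x.
  move=> AP U nU; apply: contrapT => nm; apply: nnear.
  apply: filterS nU => z Uz Fz; have [//|Pz] := AP z.
  by exfalso; apply: nm; exists z.
by split; first split=> //; have [Ax|nAx] := pselect (A x);
  [apply: subset_closure|apply: H => z; have [] := pselect (A z); tauto
  |apply: H => z; have [] := pselect (A z); tauto|apply: subset_closure].
Qed.

(** In particular, trees denoting the same ordinal give the same stage. *)
Lemma osc_iter_anti A a b : ole a b -> osc_iter A b `<=` osc_iter A a.
Proof.
elim: a b => I f IH [J g] /= ab x Dx i; have [j fg] := ab i.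
by apply: osc_derivS (Dx j); exact: IH.
Qed.

Lemma osc_iterS A a : osc_iter A (osucc a) = osc_deriv A (osc_iter A a).
Proof. by apply/seteqP; split=> [x /(_ tt)//|x Dx []]. Qed.

Lemma osc_iterC A a : osc_iter (~` A) a = osc_iter A a.
Proof.
elim: a => I f IH /=; apply/seteqP; split=> x Dx i; have := Dx i;
  by rewrite /osc_deriv IH setCK -!setIA (setIC (closure _) (closure _)).
Qed.

Lemma osc_iter_eq_on A C U : open U -> (forall z, U z -> (A z <-> C z)) ->
  forall a z, U z -> osc_iter A a z -> osc_iter C a z.
Proof.
move=> oU AC; elim=> I f IH z Uz /= Dz i.
have [[Fz cA] cnA] := Dz i; split; first split; first exact: IH.
- move=> V nV; have [|w [[Fw Aw] [Vw Uw]]] := cA (V `&` U).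
    by apply: filterI => //; exact: open_nbhs_nbhs.
  by exists w; split => //; split; [exact: IH|apply/AC].
- move=> V nV; have [|w [[Fw Aw] [Vw Uw]]] := cnA (V `&` U).
    by apply: filterI => //; exact: open_nbhs_nbhs.
  by exists w; split => //; split; [exact: IH|move=> /(AC _ Uw)].
Qed.

Lemma osc_iter_preimage A B (f : T -> T) a :
  continuous f -> f @^-1` B = A -> osc_iter A a `<=` f @^-1` osc_iter B a.
Proof.
move=> cf <-; elim: a => I g IH x /= Dx i.
have [[Fx cA] cnA] := Dx i; split; first split; first exact: IH.
- move=> V /cf nV; have [w [[Fw Aw] Vw]] := cA _ nV.
  by exists (f w); split => //; split => //; exact: IH.
- move=> V /cf nV; have [w [[Fw Aw] Vw]] := cnA _ nV.
  by exists (f w); split => //; split => //; exact: IH.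
Qed.

Hypothesis scT : scattered T.

Lemma osc_iter_vanish A x : exists a, ~ osc_iter A a x.
Proof.
apply: contrapT => /forallNP Dx.
have [|{Dx}x Sx isox] := scT (S := [set x | forall a, osc_iter A a x]).
  by exists x => a; exact: contrapT (Dx a).
have /choice [a aP] : forall z, exists a, osc_iter A a z -> forall b, osc_iter A b z.
  move=> z; have [[a na]|na] := pselect (exists a, ~ osc_iter A a z).
    by exists a.
  by exists ozero => _ b; exact: contrapT (fun nb => na (ex_intro _ b nb)).
(* [OSup a] exceeds every stage [a z], so only points that survive forever remain there. Near [x]
   the only one is [x], which cannot lie on both sides of [A]. *)
have := Sx (osucc (OSup a)); rewrite osc_iterS.
move=> /osc_derivP /(_ _ (~ A x) isox)[z [zx Dz Az]].
have zE : z = x by apply: zx; apply: (aP z); exact: osc_deriv_sub (Dz z).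
by move: Az; rewrite zE; tauto.
Qed.

(** A stage is an intersection of derivatives, so a point is always lost in passing from some stage
    to its successor. *)
Lemma osc_rank_exists A x :
  exists a, osc_iter A a x /\ ~ osc_iter A (osucc a) x.
Proof.
have [a] := osc_iter_vanish A x; elim: a => J f IH /existsNP[j ndx].
have [Dx|] := pselect (osc_iter A (f j) x); last exact: IH.
by exists (f j); rewrite osc_iterS.
Qed.

Definition osc_rank A x : Ord := projT1 (cid (osc_rank_exists A x)).

Lemma osc_iterE A a x : osc_iter A a x <-> ole a (osc_rank A x).
Proof.
rewrite /osc_rank; case: cid => r /= [Dr nDr]; split=> [Da|ar].
  by apply: contrapT => /oleNgt /osuccP ra; exact: nDr (osc_iter_anti ra Da).
exact: osc_iter_anti ar _ Dr.
Qed.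

Lemma osc_rank_leP A x B y :
  (forall a, osc_iter A a x -> osc_iter B a y) ->
  ole (osc_rank A x) (osc_rank B y).
Proof. by move=> DD; apply/osc_iterE/DD/osc_iterE; exact: ole_refl. Qed.

Lemma osc_rankC A x : osc_rank (~` A) x = osc_rank A x.
Proof.
have iE : osc_iter (~` A) = osc_iter A by apply/funext => a; exact: osc_iterC.
rewrite /osc_rank; move: (osc_rank_exists (~` A) x); rewrite iE => e.
by congr (projT1 (cid _)); exact: Prop_irrelevance.
Qed.

(* The order on the pairs (osc_rank A x, `[x \in A]): two points of equal rank
   are comparable only if they are on the same side. *)
Definition osc_le A x B y : Prop :=
  olt (osc_rank A x) (osc_rank B y) \/
  ole (osc_rank A x) (osc_rank B y) /\ (A x <-> B y).

Lemma osc_le_rank A x B y : osc_le A x B y -> ole (osc_rank A x) (osc_rank B y).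
Proof. by case=> [/oltW|[]]. Qed.

Lemma osc_le_trans B y A x C z :
  osc_le A x B y -> osc_le B y C z -> osc_le A x C z.
Proof.
move=> [xy|[xy AB]] [yz|[yz BC]].
- by left; exact: ole_olt_trans (oltW xy) yz.
- by left; exact: olt_ole_trans xy yz.
- by left; exact: ole_olt_trans xy yz.
- by right; split; [exact: ole_trans yz|rewrite AB].
Qed.

Lemma not_osc_le A x B y : ~ osc_le A x B y ->
  ole (osc_rank B y) (osc_rank A x) /\
  (ole (osc_rank A x) (osc_rank B y) -> ~ (A x <-> B y)).
Proof.
move=> nle; split; last by move=> xy AB; apply: nle; right.
by apply: contrapT => /oleNgt yx; apply: nle; left.
Qed.

(** Since [x] is lost at the next derivative, the points of its last stage near [x] are all on the
    side of [x]. *)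
Lemma osc_le_near A x : \forall z \near x, osc_le A z A x.
Proof.
have Dx : osc_iter A (osc_rank A x) x by apply/osc_iterE; exact: ole_refl.
have ndx : ~ osc_deriv A (osc_iter A (osc_rank A x)) x.
  by rewrite -osc_iterS => /osc_iterE /osuccP; exact: olt_irr.
have near0 := osc_deriv_near Dx ndx.
apply: filterS2 near0 (near_join near0) => z zA zN.
have zx : ole (osc_rank A z) (osc_rank A x).
  (* A nearby [z] of larger rank would have points of that stage on the opposite side arbitrarily
     close to it; [near_join] makes the one-sidedness hold around [z] too. *)
  apply: contrapT => /oleNgt /osuccP /osc_iterE; rewrite osc_iterS.
  by move=> /osc_derivP /(_ _ (~ A x) zN)[w [wA /wA]]; tauto.
have [|xz] := ole_olt_or_ge zx; first by left.
by right; split => //; apply/zA/osc_iterE.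
Qed.

Lemma osc_le_preimage A B (f : T -> T) x :
  continuous f -> f @^-1` B = A -> osc_le A x B (f x).
Proof.
move=> cf fB; right; split; last by rewrite -fB.
by apply: osc_rank_leP => a; exact: osc_iter_preimage cf fB _.
Qed.

(** If the rank of [y] is strictly larger, [y] is in the derivative of the stage of [x], so both
    sides of [B] occur in that stage arbitrarily near [y]. *)
Lemma osc_le_side A x B y (V : set T) : osc_le A x B y -> nbhs y V ->
  exists z, [/\ V z, ole (osc_rank A x) (osc_rank B z) & (A x <-> B z)].
Proof.
move=> [/osuccP xy|[xy AB]] nV; last by exists y; split => //; exact: nbhs_singleton.
move: xy => /osc_iterE; rewrite osc_iterS.
move=> /osc_derivP /(_ V (A x) nV)[z [Vz Dz AB]].
by exists z; split => //; [exact/osc_iterE|rewrite AB].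
Qed.

Lemma osc_rank_le_on A C U z :
  open U -> (forall w, U w -> (A w <-> C w)) -> U z ->
  ole (osc_rank A z) (osc_rank C z).
Proof.
by move=> oU acE Uz; apply: osc_rank_leP => a; exact: osc_iter_eq_on oU acE _ _ Uz.
Qed.

(** * Gluing local reductions along clopen covers *)

Hypothesis countT : countable [set: T].

(* The selector g sends z to the center of the first member of the cover that
   contains z. *)
Lemma clopen_selector (W : set T) (U : T -> set T) :
  (forall x, W x -> clopen (U x) /\ U x x) ->
  exists g : T -> T, forall z, W z ->
    [/\ W (g z), U (g z) z & \forall w \near z, g w = g z].
Proof.
move=> WU; have [c cI] := countable_injP _ countT.
have {cI}cI x y : c x = c y -> x = y by apply: cI; rewrite in_setT.
pose P z x := W x /\ U x z.
(* Membership in the first [n] members of the cover is locally constant, hence so is the first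
   member that contains [z]. *)
have P_near z n : \forall w \near z, forall x, (c x < n)%N -> (P w x <-> P z x).
  elim: n => [|n IH]; first by near=> w => x; rewrite ltn0.
  have [[x xn]|nx] := pselect (exists x, c x = n); last first.
    apply: filterS IH => w IH x; rewrite ltnS leq_eqVlt => /orP[/eqP xn|/IH//].
    by case: nx; exists x.
  have Px : \forall w \near z, P w x <-> P z x.
    have [Wx|nW] := pselect (W x); last by near=> w; rewrite /P; tauto.
    have [[oU cU] Uxx] := WU x Wx; have [Uz|nU] := pselect (U x z).
      by apply: filterS (open_near oU Uz) => w Uw; rewrite /P; tauto.
    apply: filterS (open_near (closed_openC cU) nU) => w Uw.
    by rewrite /P; move: Uw => /=; tauto.
  apply: filterS2 IH Px => w IH Px y; rewrite ltnS leq_eqVlt.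
  by move=> /orP[/eqP yn|/IH//]; have -> : y = x by apply: cI; rewrite yn xn.
have least z : W z -> exists x, P z x /\ forall y, P z y -> (c x <= c y)%N.
  move=> Wz; have [_ Uzz] := WU z Wz.
  have ex : exists n, `[< exists2 x, P z x & c x = n >].
    by exists (c z); apply/asboolP; exists z.
  case: (ex_minnP ex) => n /asboolP[x Px <-] xmin.
  by exists x; split => // y Py; apply: xmin; apply/asboolP; exists y.
pose G z x := P z x /\ forall y, P z y -> (c x <= c y)%N.
have /choice [h hP] z : exists x, (exists x, G z x) -> G z x.
  by have [[x xP]|nW] := pselect (exists x, G z x); [exists x|exists z].
exists h => z Wz; have [[Wh Uh] hmin] := hP z (least z Wz); split => //.
apply: filterS (P_near z (c (h z)).+1) => w wP.
have Gw : G w (h z).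
  split=> [|y Py]; first by apply/wP.
  have [//|yz] := leqP (c (h z)) (c y).
  have Pzy : P z y by apply/wP => //; exact: ltnW.
  by have := hmin y Pzy; rewrite leqNgt yz.
have [Pw wmin] := hP w (ex_intro _ _ Gw).
by apply: cI; apply/eqP; rewrite eqn_leq wmin ?Gw.2 //; case: Gw.
Unshelve. all: by end_near. Qed.


Hypothesis baseT : clopen_base T.
Context {R : realType}.
Variable d : T -> T -> R.
Hypotheses (md : is_metric d) (td : metric_induces_topology d).

Lemma metric_near (x : T) (e : R) : 0 < e -> \forall z \near x, d x z < e.
Proof. by move=> e0; apply/td; exists e. Qed.

Lemma near_neq (x y : T) : x <> y -> \forall z \near x, z <> y.
Proof.
move=> xy; apply: filterS (metric_near x (metric_gt0 md xy)) => z + zy.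
by rewrite zy ltxx.
Qed.

(** The bound [e] on the distance to [y] is what allows infinitely many pieces to be glued
    continuously around an accumulation point. *)
Definition local_reduction A x B y (e : R) : Prop :=
  exists U : set T, exists f : T -> T, [/\ clopen U, U x &
    forall z, U z -> [/\ {for z, continuous f}, (A z <-> B (f z)) & d y (f z) < e]].

(** Scatteredness serves as the induction principle: the set of bad points, taken over all targets
    and radii, would have an isolated point [x], and the good points around [x] yield a reduction at
    [x]. *)
Lemma osc_le_local_reduction A x B y e :
  0 < e -> osc_le A x B y -> local_reduction A x B y e.
Proof.
have [d0 dE dC dT] := md.
move=> e0 xy; apply: contrapT => nred.
pose bad x := exists y e, [/\ 0 < e, osc_le A x B y & ~ local_reduction A x B y e].
have : bad !=set0 by exists x, y, e.
move=> /scT {x y e e0 xy nred} [x [y [e [e0 xy nred]]] isox].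
apply: nred; have e20 : 0 < e / 2 by lra.
have [y' [yy' xy' AB]] := osc_le_side xy (metric_near y e20).
have [V [[oV cV] Vx VP]] : exists V, [/\ clopen V, V x &
    V `<=` [set z | osc_le A z A x /\ (bad z -> z = x)]].
  by apply: baseT; exact: filterI (osc_le_near A x) isox.
(* Points z != x near x have no larger degree and are not bad, so they can be
   reduced near y' within d x z: this makes the glued map continuous at x. *)
pose W := V `\ x.
have Wred z : W z -> exists Uf : set T * (T -> T), [/\ clopen Uf.1, Uf.1 z,
    (forall w, Uf.1 w -> d z w < d x z / 2) &
    forall w, Uf.1 w -> [/\ {for w, continuous Uf.2}, (A w <-> B (Uf.2 w)) &
      d y' (Uf.2 w) < Num.min (e / 2) (d x z)]].
  move=> [Vz /= zx]; have [zlex zbad] := VP z Vz.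
  have xz0 : 0 < d x z by apply: (metric_gt0 md) => xz; apply: zx.
  have m0 : 0 < Num.min (e / 2) (d x z) by rewrite lt_min e20.
  have [U [f [cU Uz Uf]]] : local_reduction A z B y' (Num.min (e / 2) (d x z)).
    apply: contrapT => nr; apply: zx; apply: zbad; exists y', (Num.min (e / 2) (d x z)).
    by split => //; apply: (osc_le_trans zlex); right.
  (* For [w] in the piece around [z] this forces [d x z < 2 * d x w], so the bound in terms of the
     center [z] becomes one in terms of [w]. *)
  have xz20 : 0 < d x z / 2 by lra.
  have [V' [cV' V'z V'P]] : exists V', [/\ clopen V', V' z &
      V' `<=` U `&` [set w | d z w < d x z / 2]].
    by apply: baseT; apply: filterI; [exact: open_near cU.1 Uz|exact: metric_near].
  by exists (V', f); split => //= w /V'P[]// /Uf.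
have /choice [Uf UfP] z : exists Uf : set T * (T -> T), W z -> [/\ clopen Uf.1, Uf.1 z,
    (forall w, Uf.1 w -> d z w < d x z / 2) &
    forall w, Uf.1 w -> [/\ {for w, continuous Uf.2}, (A w <-> B (Uf.2 w)) &
      d y' (Uf.2 w) < Num.min (e / 2) (d x z)]].
  by have [/Wred[Uf UfP]|nW] := pselect (W z); [exists Uf|exists (set0, id)].
have [|g gP] := @clopen_selector W (fun z => (Uf z).1).
  by move=> z /UfP[].
pose f z := if pselect (z = x) then y' else (Uf (g z)).2 z.
have fx : f x = y' by rewrite /f; case: pselect.
have fE z : z <> x -> f z = (Uf (g z)).2 z by rewrite /f; case: pselect.
have Wf z : W z -> [/\ (A z <-> B (f z)), d y' (f z) < e / 2 & d y' (f z) < d x z * 2].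
  move=> Wz; have [Wg Ug _] := gP z Wz; have [_ _ dg fg] := UfP _ Wg.
  have [_ AzB] := fg z Ug; rewrite -fE; last by case: Wz.
  rewrite lt_min => /andP[fe fd]; split => //; first by rewrite fE//; case: Wz.
  apply: lt_trans fd _; have := dg z Ug; have := dT x z (g z).
  by rewrite (dC z (g z)); lra.
exists V, f; split => // z Vz; have [->{z Vz}|zx] := pselect (z = x); last first.
  have Wz : W z by split.
  have [AzB fe _] := Wf z Wz; split => //; last first.
    by have := dT y y' (f z); move: yy' => /=; lra.
  have [Wg Ug gz] := gP z Wz; have [_ _ _ /(_ z Ug)[cf _ _]] := UfP _ Wg.
  have ff : \forall w \near z, (Uf (g z)).2 w = f w.
    by apply: filterS2 gz (near_neq zx) => w gw wx; rewrite fE// gw.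
  by move=> N; rewrite /= fE// => /cf nN; apply: filterS2 ff nN => w /= ->.
split; [|by rewrite fx|by rewrite fx; move: yy' => /=; lra].
move=> N; rewrite /= fx => /td [r r0 rN].
have r20 : 0 < r / 2 by lra.
apply: filterS2 (open_near oV Vx) (metric_near x r20) => w Vw xw /=.
apply: rN => /=; have [->|wx] := pselect (w = x).
  by rewrite fx (dE y' y').2.
by have [_ _] := Wf w (conj Vw wx); lra.
Qed.

(** A continuous reduction itself supplies the dominating points; conversely, local reductions are
    glued by [clopen_selector]. *)
Theorem wadge_leP A B : wadge_le A B <-> forall x, exists y, osc_le A x B y.
Proof.
split=> [[f cf fB] x|AB]; first by exists (f x); exact: osc_le_preimage.
have /choice [Uf UfP] x : exists Uf : set T * (T -> T), [/\ clopen Uf.1, Uf.1 x &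
    forall z, Uf.1 z -> {for z, continuous Uf.2} /\ (A z <-> B (Uf.2 z))].
  have [y xy] := AB x.
  have [U [f [cU Ux Uf]]] := osc_le_local_reduction ltr01 xy.
  by exists (U, f); split => //= z /Uf[].
have [|g gP] := @clopen_selector setT (fun z => (Uf z).1).
  by move=> z _; have [] := UfP z.
exists (fun z => (Uf (g z)).2 z).
  move=> z; have [_ Ug gz] := gP z Logic.I; have [_ _ /(_ z Ug)[cf _]] := UfP (g z).
  by move=> N /cf nN; apply: filterS2 gz nN => w /= ->.
apply/seteqP; split=> z /=; have [_ Ug _] := gP z Logic.I;
  by have [_ _ /(_ z Ug)[_ AzB]] := UfP (g z); apply AzB.
Qed.

(** * Duality and Wadge's lemma *)

Lemma not_wadge_leP A B : ~ wadge_le A B -> exists x, forall y,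
  ole (osc_rank B y) (osc_rank A x) /\
  (ole (osc_rank A x) (osc_rank B y) -> ~ (A x <-> B y)).
Proof.
move=> nAB; apply: contrapT => nx; apply/nAB/wadge_leP => x.
apply: contrapT => /forallNP nxy; apply: nx; exists x => y.
exact: not_osc_le (nxy y).
Qed.

(** A point not dominated in the complement has top rank, and every point of that rank is on its
    side. *)
Lemma not_selfdualP A : ~ selfdual A -> exists x, forall y, osc_le A y A x.
Proof.
move=> /not_wadge_leP[x xP]; exists x => y; have [yx xy] := xP y.
rewrite osc_rankC in xy yx.
have [lt|ge] := ole_olt_or_ge yx; first by left.
right; split => //; have /= := xy ge.
by have [] := pselect (A x); have [] := pselect (A y); tauto.
Qed.

Lemma selfdual_flip A x : selfdual A ->
  exists2 y, ole (osc_rank A x) (osc_rank A y) &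
    ole (osc_rank A y) (osc_rank A x) -> (A x <-> ~ A y).
Proof.
move=> /wadge_leP /(_ x)[y]; rewrite /osc_le osc_rankC => -[xy|[xy AA]]; exists y => //.
  exact: oltW.
by move=> /(olt_ole_trans xy) /olt_irr.
Qed.

(** Wadge's lemma without games: a point of [A] not dominated in [B] dominates all of [B] once its
    side is flipped. *)
Lemma wadge_le_or A B : wadge_le A B \/ wadge_le B (~` A).
Proof.
have [|/not_wadge_leP[x xP]] := pselect (wadge_le A B); first by left.
right; apply/wadge_leP => y; exists x; have [yx AB] := xP y.
rewrite /osc_le osc_rankC; have [lt|ge] := ole_olt_or_ge yx; first by left.
right; split => //; have /= := AB ge.
by have [] := pselect (A x); have [] := pselect (B y); tauto.
Qed.

Lemma osc_rank_flip_on A C U (P : Prop) z :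
  open U -> (forall w, U w -> (C w <-> (A w <-> P))) -> U z ->
  ole (osc_rank A z) (osc_rank C z) /\ ole (osc_rank C z) (osc_rank A z).
Proof.
move=> oU UC Uz; have [p|np] := pselect P.
  by split; apply: osc_rank_le_on oU _ Uz => w /UC; tauto.
by rewrite -(osc_rankC A); split; apply: osc_rank_le_on oU _ Uz => w /UC /=;
  have [] := pselect (A w); tauto.
Qed.

Lemma osc_rank_empty_near C U z b : open U -> U z -> (forall w, U w -> ~ C w) ->
  ole (osc_rank C z) b.
Proof.
move=> oU Uz UC; apply: contrapT => /oleNgt /osuccP /osc_iterE; rewrite osc_iterS.
by move=> /osc_derivP /(_ U True (open_near oU Uz))[w [/UC nC _]]; tauto.
Qed.

(** * Sets strictly between two degrees of the same type *)

Lemma isolated_clopen (E : set T) : E !=set0 ->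
  exists y U, [/\ clopen U, U y, E y & forall z, U z -> E z -> z = y].
Proof.
move=> /scT[y Ey isoy]; have [U [cU Uy UE]] := baseT isoy.
by exists y, U; split.
Qed.

(** Cutting [B] down to a clopen neighborhood of one point [y], isolated among those whose rank
    exceeds all ranks of [A], leaves [y] as the only point of top rank. *)
Lemma selfdual_gap A B : wadge_lt A B -> selfdual A -> selfdual B ->
  exists C, wadge_lt A C /\ wadge_lt C B.
Proof.
move=> [AB /not_wadge_leP[y0 y0P]] sA sB.
pose E := [set y | forall x, olt (osc_rank A x) (osc_rank B y)].
have [|y [U [[oU cU] Uy Ey Uiso]]] := @isolated_clopen E.
  (* A point of [A] with rank at least that of [y0] would, with its flip, give both sides at that
     rank; one of them agrees with [y0]. *)
  exists y0 => x; have [xy0 neq] := y0P x.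
  have [//|y0x] := ole_olt_or_ge xy0; have [x' xx' flip] := selfdual_flip x sA.
  have [x'y0 neq'] := y0P x'.
  move: (flip (ole_trans x'y0 y0x)) (neq y0x) (neq' (ole_trans y0x xx')).
  by have [] := pselect (B y0); tauto.
have [x0 _] : exists x : T, True by exists y0.
pose C := B `&` U.
have BC z : U z -> (B z <-> C z) by rewrite /C /=; tauto.
have CB z : U z -> (C z <-> B z) by rewrite /C /=; tauto.
have rBC z : U z -> ole (osc_rank B z) (osc_rank C z) by exact: osc_rank_le_on oU BC.
have rCB z : U z -> ole (osc_rank C z) (osc_rank B z) by exact: osc_rank_le_on oU CB.
have C0 z b : ~ U z -> ole (osc_rank C z) b.
  move=> nUz; apply: osc_rank_empty_near (closed_openC cU) nUz _.
  by move=> w /= nUw [].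
have Cy z : z <> y -> olt (osc_rank C z) (osc_rank B y).
  move=> zy; have [Uz|nUz] := pselect (U z); last first.
    exact: ole_olt_trans (C0 z _ nUz) (Ey x0).
  apply: ole_olt_trans (rCB z Uz) _; apply: oleNgt => yz; apply: zy.
  by apply: Uiso => // x; exact: olt_ole_trans (Ey x) yz.
exists C; split; split.
- apply/wadge_leP => x; exists y; left; exact: olt_ole_trans (Ey x) (rBC y Uy).
- move=> /wadge_leP /(_ y)[x /osc_le_rank yx].
  by have /olt_irr := olt_ole_trans (Ey x) (ole_trans (rBC y Uy) yx).
- apply/wadge_leP => z; exists y; have [->|/Cy] := pselect (z = y); last by left.
  by right; split; [exact: rCB|exact: CB].
(* In [B] the point [y] is matched by [y1], of larger rank or on the other side, which [C] cannot
   dominate. *)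
have [y1 yy1 flip] := selfdual_flip y sB.
move=> /wadge_leP /(_ y1)[z y1z].
have yz := ole_trans yy1 (osc_le_rank y1z).
have zE : z = y.
  apply: contrapT => /Cy zy; exact: olt_irr (olt_ole_trans zy yz).
move: y1z; rewrite zE => -[lt|[le]].
  exact: olt_irr (olt_ole_trans lt (ole_trans (rCB y Uy) yy1)).
have := flip (ole_trans le (rCB y Uy)); have := BC y Uy.
by have [] := pselect (B y); tauto.
Qed.

(** The set [C] has top rank [a], the top rank of [A], but attains it on both sides, while the top
    rank of [B] is strictly larger. *)
Lemma nonselfdual_gap A B : wadge_lt A B -> ~ selfdual A -> ~ selfdual B ->
  exists C, wadge_lt A C /\ wadge_lt C B.
Proof.
move=> [AB nBA] /not_selfdualP[x0 x0P] /not_selfdualP[y0 y0P].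
have x0y0 : olt (osc_rank A x0) (osc_rank B y0).
  apply: oleNgt => y0x0; have /wadge_leP /(_ x0)[y x0y] := AB.
  have [lt|[_ eqx0y0]] := osc_le_trans x0y (y0P y).
    exact: olt_irr (olt_ole_trans lt y0x0).
  apply/nBA/wadge_leP => z; exists x0; apply: osc_le_trans (y0P z) _.
  by right; split => //; tauto.
pose a := osc_rank A x0; pose E := osc_iter B a.
have EP z : E z <-> ole a (osc_rank B z) by exact: osc_iterE.
(* Rank above [a] puts [y0] in the derivative of [E], so [E] has points on both sides, hence at
   least two. *)
have dE : osc_deriv B E y0 by rewrite -osc_iterS; apply/osc_iterE/osuccP.
have [|y1 [U1 [[oU1 cU1] U1y1 Ey1 iso1]]] := @isolated_clopen E.
  by exists y0; exact: osc_deriv_sub dE.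
have [|y2 [U2 [[oU2 cU2] U2y2 [Ey2 /= y21] iso2]]] := @isolated_clopen (E `\ y1).
  have [z [_ Ez zB]] := osc_derivP dE (~ B y1) filterT.
  by exists z; split => // zy; move: zB; rewrite zy; tauto.
(* Around each [yi] this is [B] or its complement, chosen so that [y1] is in [C] and [y2] is not;
   elsewhere it is empty. *)
pose C := [set z | U1 z /\ (B z <-> B y1) \/ ~ U1 z /\ U2 z /\ ~ (B z <-> B y2)].
pose V2 := U2 `\` U1.
have oV2 : open V2 by apply: openI => //; exact: closed_openC.
have V2y2 : V2 y2 by split=> // /iso1 /(_ Ey2).
have C1 w : U1 w -> (C w <-> (B w <-> B y1)) by rewrite /C /=; tauto.
have C2 w : V2 w -> (C w <-> (B w <-> ~ B y2)).
  move=> [Uw nUw]; rewrite /C /=.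
  by have [] := pselect (B y2); have [] := pselect (B w); tauto.
have iso2' z : V2 z -> E z -> z = y2.
  by move=> [Uz nUz] Ez; apply: iso2 => //; split => // zy1; apply: nUz; rewrite zy1.
have Ca z : ole (osc_rank C z) a.
  have iso_rank U y P : open U -> (forall w, U w -> E w -> w = y) ->
      (forall w, U w -> (C w <-> (B w <-> P))) -> U z -> ole (osc_rank C z) a.
    move=> oU iso UC Uz; apply: ole_trans (osc_rank_flip_on oU UC Uz).2 _.
    apply: contrapT => /oleNgt az.
    have : osc_deriv B E z by rewrite -osc_iterS; apply/osc_iterE/osuccP.
    move=> /osc_derivP /(_ U (~ B z) (open_near oU Uz))[w [Uw Ew wB]].
    have wz : w = z by rewrite (iso w)// (iso z)//; exact/EP/oltW.
    by move: wB; rewrite wz; tauto.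
  have [Uz|nUz] := pselect (U1 z); first exact: iso_rank oU1 iso1 C1 Uz.
  have [Vz|nVz] := pselect (V2 z); first exact: iso_rank oV2 iso2' C2 Vz.
  apply: (@osc_rank_empty_near C (~` U1 `&` ~` U2)) => //.
  - by apply: openI; exact: closed_openC.
  - by split => // U2z; exact: nVz.
  - by move=> w /= [nU1 nU2]; rewrite /C /=; tauto.
have rC1 : ole a (osc_rank C y1).
  by apply: ole_trans (osc_rank_flip_on oU1 C1 U1y1).1; apply/EP.
have rC2 : ole a (osc_rank C y2).
  by apply: ole_trans (osc_rank_flip_on oV2 C2 V2y2).1; apply/EP.
have Cy1 : C y1 by apply/C1.
have Cy2 : ~ C y2 by move=> /(C2 _ V2y2); tauto.
(* Every pair of [A] lies below that of [x0], so a reduction of [C] to [A] would put [y1] and [y2]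
   on the same side. *)
have top y x : ole a (osc_rank C y) -> osc_le C y A x -> C y <-> A x0.
  move=> ay yx; have [lt|[_ ->//]] := osc_le_trans yx (x0P x).
  by have /olt_irr := ole_olt_trans ay lt.
exists C; split; split.
- apply/wadge_leP => x; have xa := osc_le_rank (x0P x).
  have [Ax|nAx] := pselect (A x).
    by exists y1; right; split; [exact: ole_trans rC1|tauto].
  by exists y2; right; split; [exact: ole_trans rC2|tauto].
- move=> /wadge_leP CA; have [z1 z1P] := CA y1; have [z2 z2P] := CA y2.
  by have := top _ _ rC1 z1P; have := top _ _ rC2 z2P; tauto.
- apply/wadge_leP => z; exists y0; left; exact: ole_olt_trans (Ca z) x0y0.
- move=> /wadge_leP /(_ y0)[z /osc_le_rank y0z].
  exact: olt_irr (olt_ole_trans x0y0 (ole_trans y0z (Ca z))).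
Qed.

(** * Well-foundedness of the Wadge order and properties of the rank *)

Definition osc_length A : Ord := olub (fun x => osucc (osc_rank A x)).

Lemma osc_length_ltP a A : olt a (osc_length A) <-> exists x, ole a (osc_rank A x).
Proof.
by rewrite /osc_length olubP_lt; split=> -[x ax]; exists x;
  [case: ax|exists tt].
Qed.

(** At equal length, a selfdual [C] would dominate [A] by using both sides, and two nonselfdual sets
    would have tops of equal rank on the same side. *)
Lemma wadge_lt_osc_length C A : wadge_lt C A ->
  olt (osc_length C) (osc_length A) \/
  [/\ ole (osc_length C) (osc_length A), selfdual A & ~ selfdual C].
Proof.
move=> [CA nAC].
have lCA : ole (osc_length C) (osc_length A).
  apply/olubP => x; have /wadge_leP /(_ x)[y /osc_le_rank xy] := CA.
  by apply/osuccP/osc_length_ltP; exists y.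
have [|lAC] := ole_olt_or_ge lCA; [by left|right].
have lAC' x : exists y, ole (osc_rank A x) (osc_rank C y).
  by apply/osc_length_ltP/osuccP; have /olubP := lAC; apply.
have nsC : ~ selfdual C.
  move=> sC; have [x xP] := not_wadge_leP nAC; have [y xy] := lAC' x.
  have [y' yy' flip] := selfdual_flip y sC.
  have [yx neq] := xP y; have [y'x neq'] := xP y'.
  move: (neq xy) (neq' (ole_trans xy yy')) (flip (ole_trans y'x xy)).
  by have [] := pselect (A x); tauto.
split => //; apply: contrapT => /not_selfdualP[x0 x0P].
have [y0 y0P] := not_selfdualP nsC; have [y x0y] := lAC' x0.
have x0y0 := ole_trans x0y (osc_le_rank (y0P y)).
have /wadge_leP /(_ y0)[x y0x] := CA.
have [lt|[_ eqy0x0]] := osc_le_trans y0x (x0P x).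
  exact: olt_irr (olt_ole_trans lt x0y0).
apply/nAC/wadge_leP => z; exists y0; apply: osc_le_trans (x0P z) _.
by right; split => //; tauto.
Qed.

(** Descent at constant length can only go from selfdual to nonselfdual, hence at most once;
    nonselfdual sets are therefore treated first. *)
Lemma wadge_lt_wf : well_founded (@wadge_lt T).
Proof.
suff H b : forall A, ole (osc_length A) b -> Acc (@wadge_lt T) A.
  by move=> A; exact: H (ole_refl _).
elim/(well_founded_ind olt_wf): b => b IH.
have step C A : ole (osc_length A) b -> olt (osc_length C) (osc_length A) ->
    Acc (@wadge_lt T) C.
  by move=> Ab /olt_ole_trans /(_ Ab) Cb; exact: IH Cb _ (ole_refl _).
have nsd A : ole (osc_length A) b -> ~ selfdual A -> Acc (@wadge_lt T) A.
  move=> Ab nsA; split=> C /wadge_lt_osc_length[CA|[_ /nsA//]].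
  exact: step Ab CA.
move=> A Ab; split=> C /wadge_lt_osc_length[CA|[CA _ nsC]].
  exact: step Ab CA.
by apply: nsd nsC; exact: ole_trans Ab.
Qed.

Lemma wadge_le_trans B A C : wadge_le A B -> wadge_le B C -> wadge_le A C.
Proof.
move=> /wadge_leP AB /wadge_leP BC; apply/wadge_leP => x.
by have [y xy] := AB x; have [z yz] := BC y; exists z; exact: osc_le_trans yz.
Qed.

Lemma wadge_rank_ltP a A : olt a (wadge_rank A) <->
  olt a oone \/ exists2 B, wadge_lt B A & ole a (wadge_rank B).
Proof.
rewrite (wadge_rankE (wadge_lt_wf A)) olubP_lt; split.
  move=> [[[B BA]|] /= h]; last by left.
  by right; exists B => //; case: h.
move=> [a1|[B BA aB]]; first by exists None.
by exists (Some (exist _ B BA)); exists tt.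
Qed.

Lemma wadge_rank_lt A B : wadge_lt A B -> olt (wadge_rank A) (wadge_rank B).
Proof. by move=> AB; apply/wadge_rank_ltP; right; exists A => //; exact: ole_refl. Qed.

Lemma wadge_rank_le A B : wadge_le A B -> ole (wadge_rank A) (wadge_rank B).
Proof.
move=> AB; apply: contrapT => /oleNgt /wadge_rank_ltP[lt|[C [CA nAC] BC]].
  by apply: olt_irr; apply: (olt_ole_trans lt); apply/osuccP/wadge_rank_ltP; left;
     apply/osuccP/ole_refl.
have /wadge_rank_lt : wadge_lt C B.
  by split; [exact: wadge_le_trans AB|move=> BC'; apply: nAC; exact: wadge_le_trans BC'].
by move=> /olt_ole_trans /(_ BC) /olt_irr.
Qed.

Lemma wadge_ltC A B : wadge_lt (~` A) B -> wadge_lt A (~` B).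
Proof.
have leC C D : wadge_le C D -> wadge_le (~` C) (~` D).
  by move=> [f cf <-]; exists f.
by move=> [/leC AB nBA]; rewrite setCK in AB; split => // /leC; rewrite setCK.
Qed.

Lemma wadge_rankC A : ole (wadge_rank (~` A)) (wadge_rank A).
Proof.
elim/(well_founded_ind wadge_lt_wf): A => A IH.
apply: contrapT => /oleNgt /wadge_rank_ltP[lt|[C CA AC]].
  apply: olt_irr; apply: (olt_ole_trans lt).
  by apply/osuccP/wadge_rank_ltP; left; apply/osuccP/ole_refl.
have CA' : wadge_lt (~` C) A by rewrite -[A]setCK; apply: wadge_ltC; rewrite setCK.
have := IH _ CA'; rewrite setCK => CC.
exact: olt_irr (ole_olt_trans (ole_trans AC CC) (wadge_rank_lt CA')).
Qed.

(** By Wadge's lemma the alternative is that [B] reduces to the complement of [A], whose rank is at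
    most that of [A]. *)
Lemma wadge_lt_of_rank A B : olt (wadge_rank A) (wadge_rank B) -> wadge_lt A B.
Proof.
move=> AB; split; last by move=> /wadge_rank_le /(olt_ole_trans AB) /olt_irr.
have [//|/wadge_rank_le BA] := wadge_le_or A B.
by have /olt_irr := olt_ole_trans AB (ole_trans BA (wadge_rankC A)).
Qed.

(** A Wadge-minimal set among those of rank at least [a] has rank exactly [a]. *)
Lemma wadge_rank_realized a : ole oone a -> olt a (wadge_length T) ->
  exists A : set T, oeq (wadge_rank A) a.
Proof.
move=> a1 /olubP_lt[A0 [_ /= aA0]].
elim/(well_founded_ind wadge_lt_wf): A0 aA0 => A IH aA.
have [|Aa] := ole_olt_or_ge aA; last by exists A.
move=> /wadge_rank_ltP[lt|[B BA aB]]; last exact: IH BA aB.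
by have /olt_irr := olt_ole_trans lt a1.
Qed.

(** * Alternation of consecutive ranks *)

Lemma alternating_property_scattered : alternating_property T.
Proof.
move=> a a1 aS; have aL : olt a (wadge_length T).
  by apply: ole_olt_trans aS; apply: oltW; apply/osuccP/ole_refl.
have aS1 : ole oone (osucc a).
  by apply: ole_trans a1 _; apply: oltW; apply/osuccP/ole_refl.
have [B [Ba aB]] := wadge_rank_realized aS1 aS.
(* No rank fits strictly between [a] and its successor, so both gap lemmas contradict this. *)
have gap A C : oeq (wadge_rank A) a -> oeq (wadge_rank C) (osucc a) ->
    wadge_lt A C /\ ~ (exists D, wadge_lt A D /\ wadge_lt D C).
  move=> [Aa aA] [Ca aC]; split.
    by apply/wadge_lt_of_rank/osuccP; apply: ole_trans aC.
  move=> [D [/wadge_rank_lt AD /wadge_rank_lt DC]].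
  have /osuccP aD := ole_olt_trans aA AD.
  exact: olt_irr (ole_olt_trans (ole_trans Ca aD) DC).
split=> [[_ _ sdA]|[_ _ nsd]].
  split => // -[_ _ sdB]; have [A Aa] := wadge_rank_realized a1 aL.
  have [AB] := gap A B Aa (conj Ba aB); apply.
  exact: selfdual_gap AB (sdA A Aa) (sdB B (conj Ba aB)).
split => // A Aa; apply: contrapT => nsA; apply: nsd; split => // C Cs.
apply: contrapT => nsC; have [AC] := gap A C Aa Cs; apply.
exact: nonselfdual_gap AC nsA nsC.
Qed.

End WadgeOrder.

Theorem theorem4p6 (R : realType) (X : topologicalType)
    (polishX : polish R X) (countableX : countable [set: X])
    (nonemptyX : [set: X] !=set0) :
  alternating_property X.
Proof.
have [_ [d [md td compl]]] := polishX.
have baseX := countable_metric_clopen_base md td countableX.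
have scX := countable_complete_scattered md td compl countableX.
exact: (alternating_property_scattered scX countableX baseX md td).
Qed.
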